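(* Let $r\ge 3$ be an integer and let $h^r_e$ be the bipartite ELC-preserved graph defined in the context, with partitions of sizes $r+1$ and $2^r-r-1$. Applying $2^r-r-1$ LC operations to $h^r_e$, in any order, one to each vertex in the partition of size $2^r-r-1$, preserves the graph. Applying $r+1$ LC operations to $h^r_e$, in any order, one to each vertex in the partition of size $r+1$, gives an ELC-preserved graph $h^r_*$, which is non-bipartite when $r\ge 4$.
   Context: All graphs are finite, simple and undirected. For a graph $G=(V,E)$ and $v\in V$, $N_v$ is the set of vertices adjacent to $v$. Local complementation (LC) on $v$ transforms $G$ into $G*v$ by replacing the induced subgraph of $G$ on $N_v$ by its complement. For an edge $\{u,v\}\in E$, edge local complementation (ELC) on $\{u,v\}$ transforms $G$ into $G^{(u,v)}=G*u*v*u=G*v*u*v$ (operations applied from left to right). $G$ is ELC-preserved if for every edge $\{u,v\}\in E$, $G^{(u,v)}$ is isomorphic to $G$. The graph $h^r$ is the bipartite graph on $2^r-1$ vertices with partitions $U$, of size $r$, and $W$, of size $2^r-r-1$, where $W$ is the disjoint union of sets $W_i$, $2\le i\le r$, with $|W_i|=\binom{r}{i}$; each vertex in $W_i$ is adjacent to exactly $i$ vertices of $U$, and $N_a\ne N_b$ for all distinct $a,b\in W$. The graph $h^r_e$ is obtained from $h^r$ by adding a new vertex adjacent to all vertices of $h^r$ of even degree; it is bipartite with partitions $U\cup\{\text{new vertex}\}$, of size $r+1$, and $W$, of size $2^r-r-1$. (For $r=3$, where both sizes equal 4, ''the partition of size $r+1$'' means $U$ together with the new vertex, and ''the partition of size $2^r-r-1$''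 means $W$.) *)

(* Defs.v *)
From HB Require Import structures.
From mathcomp Require Import all_boot.

Set Implicit Arguments.
Unset Strict Implicit.
Unset Printing Implicit Defensive.

(* Graphs on a common vertex type are compared with =2, i.e. as labelled
   graphs; isomorphism is [isomorphic] below. *)
Record sgraph (V : finType) := SGraph {
  adj :> rel V;
  adj_sym : symmetric adj;
  adj_irr : irreflexive adj }.

Definition nbr (V : finType) (G : sgraph V) (v : V) : {set V} :=
  [set x | G v x].

Definition lc_adj (V : finType) (G : sgraph V) (v : V) : rel V :=
  fun x y => if (x \in nbr G v) && (y \in nbr G v)
             then (x != y) && ~~ G x y else G x y.

Lemma lc_adj_sym (V : finType) (G : sgraph V) (v : V) : symmetric (lc_adj G v).
Proof. by move=> x y; rewrite /lc_adj andbC eq_sym adj_sym. Qed.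

Lemma lc_adj_irr (V : finType) (G : sgraph V) (v : V) :
  irreflexive (lc_adj G v).
Proof. by move=> x; rewrite /lc_adj eqxx adj_irr; case: ifP. Qed.

Definition lc (V : finType) (G : sgraph V) (v : V) : sgraph V :=
  SGraph (lc_adj_sym G v) (lc_adj_irr G v).

(* The head of [s] is applied first. *)
Definition lcs (V : finType) (G : sgraph V) (s : seq V) : sgraph V :=
  foldl (@lc V) G s.

Definition elc (V : finType) (G : sgraph V) (u v : V) : sgraph V :=
  lcs G [:: u; v; u].

Definition isomorphic (V V' : finType) (G : sgraph V) (H : sgraph V') : Prop :=
  exists2 f : V -> V', bijective f & forall x y, H (f x) (f y) = G x y.

Definition elc_preserved (V : finType) (G : sgraph V) : Prop :=
  forall u v, G u v -> isomorphic (elc G u v) G.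

Definition independent (V : finType) (G : sgraph V) (A : {set V}) : Prop :=
  {in A &, forall x y, ~~ G x y}.

Definition bipartition (V : finType) (G : sgraph V) (A B : {set V}) : Prop :=
  [/\ A :|: B = [set: V], [disjoint A & B], independent G A
    & independent G B].

Definition bipartite (V : finType) (G : sgraph V) : Prop :=
  exists A B : {set V}, bipartition G A B.

(* [G] is (a copy of) the graph h^r, with partitions [U] and [W]; the
   conditions determine [G] up to isomorphism, and [is_hr_hr] gives a model. *)
Definition is_hr (r : nat) (V : finType) (G : sgraph V) (U W : {set V}) : Prop :=
  [/\ #|V| = 2 ^ r - 1, bipartition G U W, #|U| = r, #|W| = 2 ^ r - r - 1
    & exists Wi : nat -> {set V},
      [/\ W = \bigcup_(2 <= i < r.+1) Wi i,
          forall i j, 2 <= i <= r -> 2 <= j <= r -> i != j ->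
            [disjoint Wi i & Wi j],
          forall i, 2 <= i <= r -> #|Wi i| = 'C(r, i),
          forall i, 2 <= i <= r ->
            {in Wi i, forall w, #|nbr G w :&: U| = i}
        & {in W &, forall a b, a != b -> nbr G a != nbr G b}]].

(* [even_ext G] adds to [G] the vertex [None], adjacent to the vertices of even
   degree in [G]; for [G] a copy of h^r this is h^r_e. *)
Definition even_ext_adj (V : finType) (G : sgraph V) : rel (option V) :=
  fun x y => match x, y with
    | Some a, Some b => G a b
    | Some a, None | None, Some a => ~~ odd #|nbr G a|
    | None, None => false
    end.

Lemma even_ext_sym (V : finType) (G : sgraph V) : symmetric (even_ext_adj G).
Proof. by case=> [a|] [b|] //=; rewrite adj_sym. Qed.

Lemma even_ext_irr (V : finType) (G : sgraph V) : irreflexive (even_ext_adj G).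
Proof. by case=> [a|] //=; rewrite adj_irr. Qed.

Definition even_ext (V : finType) (G : sgraph V) : sgraph (option V) :=
  SGraph (even_ext_sym G) (even_ext_irr G).

(* A model of h^r: the nonempty subsets of 'I_r, where U consists of the
   singletons, and [set x] is adjacent to the larger sets containing x. *)
Definition hr_vertex (r : nat) : finType := {A : {set 'I_r} | A != set0}.

Definition hr_adj (r : nat) : rel (hr_vertex r) := fun A B =>
  (#|val A| == 1) && (val A \proper val B)
  || (#|val B| == 1) && (val B \proper val A).

Lemma hr_adj_sym (r : nat) : symmetric (@hr_adj r).
Proof. by move=> A B; rewrite /hr_adj orbC. Qed.

Lemma hr_adj_irr (r : nat) : irreflexive (@hr_adj r).
Proof. by move=> A; rewrite /hr_adj properxx andbF. Qed.

Definition hr (r : nat) : sgraph (hr_vertex r) :=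
  SGraph (@hr_adj_sym r) (@hr_adj_irr r).

Definition hr_layer (r i : nat) : {set hr_vertex r} :=
  [set A : hr_vertex r | #|val A| == i].

Definition hr_U (r : nat) : {set hr_vertex r} := hr_layer r 1.

Definition hr_W (r : nat) : {set hr_vertex r} :=
  [set A : hr_vertex r | 1 < #|val A|].

Lemma card_hr_layer (r i : nat) : 0 < i -> #|hr_layer r i| = 'C(r, i).
Proof.
move=> i0; rewrite -[r in RHS]card_ord -card_draws -(card_imset _ val_inj).
apply: eq_card => A; rewrite inE; apply/imsetP/idP => [[B]|cA].
  by rewrite inE => /eqP cB ->; rewrite cB.
have A0 : A != set0 by rewrite -card_gt0 (eqP cA).
by exists (Sub A A0); rewrite ?inE.
Qed.

Lemma card_hr_vertex (r : nat) : #|hr_vertex r| = 2 ^ r - 1.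
Proof.
rewrite card_sig -[r in RHS]card_ord -cardsT -card_powerset powersetT subn1.
by rewrite cardsT -(cardC1 (set0 : {set 'I_r})).
Qed.

Lemma hr_WE (r : nat) : hr_W r = ~: hr_U r.
Proof.
apply/setP => A; rewrite !inE ltn_neqAle eq_sym.
by rewrite card_gt0 (valP A) andbT.
Qed.

Lemma is_hr_hr (r : nat) : is_hr r (hr r) (hr_U r) (hr_W r).
Proof.
have cU : #|hr_U r| = r by rewrite card_hr_layer // bin1.
split=> //; first exact: card_hr_vertex.
- split.
  + by rewrite hr_WE setUCr.
  + by rewrite hr_WE -setI_eq0 setICr.
  + move=> A B; rewrite !inE => /eqP cA /eqP cB.
    rewrite /= /hr_adj cA cB /= negb_or.
    by apply/andP; split; apply/negP => /proper_card; rewrite cA cB.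
  + move=> A B; rewrite !inE => cA cB /=.
    by rewrite /hr_adj (gtn_eqF cA) (gtn_eqF cB).
- by rewrite hr_WE cardsCs setCK cU card_hr_vertex subnAC.
exists (hr_layer r); split.
- apply/setP => A.
  rewrite (big_morph (fun B : {set _} => A \in B) (in_setU A) (in_set0 A)).
  rewrite big_has inE; apply/idP/hasP => [cA | [i]].
    exists #|val A|; rewrite ?inE ?eqxx // mem_index_iota cA ltnS.
    by have := max_card (mem (val A)); rewrite card_ord.
  by rewrite mem_index_iota inE => /andP[i2 _] /eqP ->.
- move=> i j _ _ ij; rewrite -setI_eq0; apply/eqP/setP => A; rewrite !inE.
  by apply/negbTE; apply/negP => /andP[/eqP -> /eqP E]; rewrite E eqxx in ij.
- by move=> i /andP[i2 _]; rewrite card_hr_layer // ltnW.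
- move=> i /andP[i2 _] w; rewrite inE => /eqP cw.
  rewrite -(card_imset _ val_inj) -[RHS]cw.
  rewrite -(card_imset (mem (val w)) (@set1_inj _)).
  apply: eq_card => A; apply/imsetP/imsetP.
    case=> B; rewrite !inE /= /hr_adj cw (gtn_eqF i2) /= => /andP[/andP[_ sB]].
    case/cards1P=> x Ex ->; exists x => //.
    by have := proper_sub sB; rewrite Ex sub1set.
  case=> x xw ->.
  have x0 : [set x] != set0 by rewrite -card_gt0 cards1.
  exists (Sub [set x] x0 : hr_vertex r) => //.
  rewrite !inE /= /hr_adj cw (gtn_eqF i2) /= cards1 eqxx /=.
  by rewrite properEcard sub1set xw cards1 cw i2.
- move=> a b; rewrite !inE => ca cb; apply: contraNneq => /setP E.
  have mem (w : hr_vertex r) (cw : 1 < #|val w|) x (x0 : [set x] != set0) :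
      ((Sub [set x] x0 : hr_vertex r) \in nbr (hr r) w) = (x \in val w).
    rewrite inE /= /hr_adj (gtn_eqF cw) /= cards1 eqxx /=.
    by rewrite properEcard sub1set cards1 cw andbT.
  apply/eqP/val_inj/setP => x.
  have x0 : [set x] != set0 by rewrite -card_gt0 cards1.
  by rewrite -(mem a ca x x0) -(mem b cb x x0) E.
Qed.

(* Main.v *)
Require Import Defs.
From HB Require Import structures.
From mathcomp Require Import all_boot.

Set Implicit Arguments.
Unset Strict Implicit.
Unset Printing Implicit Defensive.

(** Let P be U together with the new vertex.  In h^r the vertices of W are the
    subsets of U of size at least 2, and every vertex of U has odd degree.
    Hence the new vertex sees exactly the vertices of W that are even subsets,
    and joining it to them turns every vertex of W into an odd subset of P of
    size at least 3.  Identifying the vertices of P with the singletons, the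
    vertices of h^r_e are all odd subsets of P, and adjacency with a vertex of
    P is membership ([trace] is this identification, and it is onto by
    counting).

    LC operations at the vertices of an independent set do not interfere: they
    toggle the pair x, y once for every common neighbour in that set
    ([lcs_independent_set]).
    - On the large side, the pair a, b of vertices of P is toggled once for
      every odd subset containing both.  Adding to a subset, modulo 2, a pair
      of two other elements of P is a fixed-point-free involution on these, so
      their number is even and nothing changes ([lcs_outer]).
    - On P, the pair x, y outside P is toggled |x :&: y| times.  The result is
      the graph on all odd subsets in which distinct x, y are adjacent exactly
      when |x :&: y| is odd, that is, when <x, y> = 1 for the standard bilinear
      form over F_2 ([lcs_inner]).

    In the latter graph, ELC on the edge uv replaces <x, y> by
    <x, y> + <x, u><y, v> + <x, v><y, u> ([elc_gram]).  The linear involution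
    x |-> x + <x, u>(u + v) transforms the old form into the new one, because
    <u + v, u + v> = 0, and it permutes the odd vectors; so it is the required
    isomorphism ([star_elc_preserved]).  If P has five elements 1, ..., 5, then {1},
    {1, 2, 3} and {1, 4, 5} form a triangle ([star_not_bipartite]). *)

(** * Subsets as vectors over F_2 *)

Definition symdiff {T : finType} (A B : {set T}) : {set T} :=
  [set x | (x \in A) (+) (x \in B)].

Definition dot (T : finType) (A B : {set T}) : bool := odd #|A :&: B|.

Lemma odd_card_sum (T : finType) (A : {set T}) :
  odd #|A| = \big[addb/false]_x (x \in A).
Proof.
rewrite -sum1_card (big_morph odd oddD (erefl : odd 0 = false)) big_mkcond /=.
by apply: eq_bigr => x _; case: (x \in A).
Qed.

Lemma odd_symdiff (T : finType) (A B : {set T}) :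
  odd #|symdiff A B| = odd #|A| (+) odd #|B|.
Proof.
by rewrite !odd_card_sum -big_split /=; apply: eq_bigr => x _; rewrite inE.
Qed.

Lemma dotC (T : finType) (A B : {set T}) : dot A B = dot B A.
Proof. by rewrite /dot setIC. Qed.

Lemma dot_symdiffl (T : finType) (A B C : {set T}) :
  dot (symdiff A B) C = dot A C (+) dot B C.
Proof.
rewrite /dot -odd_symdiff; congr (odd #|pred_of_set _|); apply/setP => x.
by rewrite !inE; case: (x \in C); rewrite ?andbT ?andbF.
Qed.

Lemma dot_symdiffr (T : finType) (A B C : {set T}) :
  dot C (symdiff A B) = dot C A (+) dot C B.
Proof. by rewrite !(dotC C) dot_symdiffl. Qed.

Lemma dot_set1 (T : finType) (a : T) (A : {set T}) : dot [set a] A = (a \in A).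
Proof.
rewrite /dot; case: (boolP (a \in A)) => aA.
  by rewrite (setIidPl _) ?sub1set // cards1.
by rewrite disjoint_setI0 ?cards0 // disjoints1.
Qed.

Lemma symdiffK (T : finType) (B : {set T}) : involutive (symdiff^~ B).
Proof. by move=> A; apply/setP => x; rewrite !inE -addbA addbb addbF. Qed.

Lemma symdiff_sub (T : finType) (P A B : {set T}) :
  A \subset P -> B \subset P -> symdiff A B \subset P.
Proof.
move=> /subsetP sA /subsetP sB; apply/subsetP => x; rewrite inE.
by case: (boolP (x \in A)) => [/sA // | _ /= /sB].
Qed.

(** The involution f exchanges the elements of S that satisfy p with those that
    do not.  This serves both to show that a set has even size and to count its
    elements that satisfy p. *)
Lemma card_flip (T : finType) (f : T -> T) (p : pred T) (S : {set T}) :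
    involutive f -> {in S, forall x, f x \in S} ->
    {in S, forall x, p (f x) = ~~ p x} ->
  #|S| = #|[set x in S | p x]|.*2.
Proof.
move=> fK fS fp; rewrite -addnn -(cardsID [set x | p x] S); congr (_ + _).
  by apply: eq_card => x; rewrite !inE.
rewrite -(card_imset _ (can_inj fK)); apply: eq_card => x.
rewrite !inE; apply/imsetP/andP => [[y]|[xS px]].
  by rewrite !inE => /andP[npy yS] ->; rewrite fS ?fp.
by exists (f x); rewrite ?fK // !inE fS ?fp // px.
Qed.

(** Adding a fixed element a of P, modulo 2, exchanges odd and even subsets. *)
Lemma card_odd_subsets (T : finType) (P : {set T}) : 0 < #|P| ->
  #|[set A : {set _} in powerset P | odd #|A| ]| = 2 ^ #|P|.-1.
Proof.
move=> P0; have /card_gt0P[a aP] := P0.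
apply: double_inj; rewrite -(card_flip (symdiffK [set a])).
- by rewrite card_powerset -{1}(prednK P0) expnS mul2n.
- by move=> A; rewrite !inE => sA; rewrite symdiff_sub ?sub1set.
- by move=> A _; rewrite odd_symdiff cards1 addbT.
Qed.

Lemma inj_onto (T T' : finType) (f : T -> T') (D : {set T'}) :
    injective f -> (forall x, f x \in D) -> #|D| <= #|T| ->
  forall y, y \in D -> exists x, f x = y.
Proof.
move=> fI fD leD y yD.
have /eqP E : f @: [set: T] == D.
  rewrite eqEcard card_imset // cardsT leD andbT.
  by apply/subsetP => _ /imsetP[x _ ->].
by move: yD; rewrite -E => /imsetP[x _ ->]; exists x.
Qed.

(** * Local complementation *)

Section LocalComplementation.
Variable T : finType.
Implicit Types (G : sgraph T) (s : seq T).

Lemma lcE G v x y : lc G v x y = G x y (+) [&& x != y, G v x & G v y].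
Proof.
rewrite /= /lc_adj !inE; case: (eqVneq x y) => [->|] /=.
  by rewrite adj_irr; case: ifP.
by case: ifP => /= _; rewrite ?addbF ?addbT.
Qed.

(** Local complementation at v leaves the neighbourhood of every vertex that is
    not adjacent to v as it was; so, within an independent set, each operation
    toggles the pairs that it would toggle in G itself. *)
Lemma lcs_independent G s x y : {in s &, forall u v, ~~ G u v} ->
  lcs G s x y = G x y (+) ((x != y) && odd (count (fun v => G v x && G v y) s)).
Proof.
elim: s G => [|v s IH] G indep; first by rewrite /= andbF addbF.
have lc_s u z : u \in s -> lc G v u z = G u z.
  move=> us; rewrite lcE (negbTE (indep v u _ _)) ?inE ?eqxx ?us ?orbT //.
  by rewrite andbF addbF.
rewrite [LHS]/= -/(lcs _ _) IH.
  rewrite lcE (@eq_in_count _ _ (fun v => G v x && G v y)); last first.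
    by move=> u us /=; rewrite -!lc_s.
  by rewrite /= oddD; case: (x != y); case: (G v x); case: (G v y);
    rewrite ?addbF ?addbA.
by move=> a b aS bS; rewrite lc_s // indep ?inE ?aS ?bS ?orbT.
Qed.

Lemma lcs_independent_set G (A : {set T}) s x y :
    independent G A -> uniq s -> s =i A ->
  lcs G s x y =
    G x y (+) ((x != y) && odd #|[set v in A | G v x && G v y]|).
Proof.
move=> indep s_uniq sA; rewrite lcs_independent; last first.
  by move=> u v; rewrite !sA; apply: indep.
congr (_ (+) (_ && odd _)); rewrite -size_filter cardE; apply: perm_size.
apply: uniq_perm => [||v]; first exact: filter_uniq.
  exact: enum_uniq.
by rewrite mem_filter mem_enum inE sA andbC.
Qed.

(** Computing the three local complementations gives the stated expression when
    x and y differ from u and v.  That b is reflexive makes it correct in the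
    remaining cases also, where ELC exchanges the neighbourhoods of u and v: for
    x = u it reduces to b v y. *)
Lemma elc_gram G (b : rel T) u v :
    symmetric b -> reflexive b -> (forall x y, G x y = (x != y) && b x y) ->
    G u v ->
  forall x y, elc G u v x y =
    (x != y) && (b x y (+) (b x u && b y v) (+) (b x v && b y u)).
Proof.
move=> bC bxx GE; rewrite GE => /andP[uv buv] x y.
have vu : v != u by rewrite eq_sym.
have bvu : b v u by rewrite bC.
rewrite /elc /lcs [foldl _ _ _]/= !lcE !GE.
case: (eqVneq x y) => [-> //|xy] /=.
have yx : y != x by rewrite eq_sym.
rewrite !(bC u) !(bC v).
have [xu|xu] := eqVneq x u; have [xv|xv] := eqVneq x v;
have [yu|yu] := eqVneq y u; have [yv|yv] := eqVneq y v; subst;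
  rewrite ?eqxx ?bxx ?buv ?bvu ?uv ?vu ?xu ?xv ?yu ?yv in xy yx uv *;
  rewrite ?(eq_sym u) ?(eq_sym v) ?eqxx ?uv ?vu ?xu ?xv ?yu ?yv ?xy ?yx //=;
  rewrite ?bxx ?buv ?bvu ?(bC u) ?(bC v) ?bxx ?buv ?bvu /=;
  repeat case: (b _ _) => //.
Qed.

Lemma triangle_not_bipartite G x y z :
  G x y -> G y z -> G x z -> ~ bipartite G.
Proof.
move=> xy yz xz [A [B [/setP AB _ iA iB]]].
have side C a c : independent G C -> G a c -> a \in C -> c \in C -> False.
  by move=> iC ac aC cC; move: (iC a c aC cC); rewrite ac.
move: (AB x) (AB y) (AB z); rewrite !inE.
move=> /orP[hx|hx] /orP[hy|hy] /orP[hz|hz].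
all: try by [apply: (side A x y) | apply: (side A y z) | apply: (side A x z)
  | apply: (side B x y) | apply: (side B y z) | apply: (side B x z)].
Qed.

(** * Vertices as subsets of one side of a bipartite graph *)

(** Sending the vertices of P to singletons instead of to their neighbourhoods
    puts both sides of the graph into the same space of subsets of P. *)
Definition trace G (P : {set T}) x := if x \in P then [set x] else nbr G x.

Lemma trace_inj G (P : {set T}) :
    {in ~: P, forall x, 1 < #|nbr G x|} -> {in ~: P &, injective (nbr G)} ->
  injective (trace G P).
Proof.
move=> big inj x y; rewrite /trace.
case: (boolP (x \in P)) => xP; case: (boolP (y \in P)) => yP.
- exact: set1_inj.
- by move=> E; move: (big y); rewrite inE yP -E cards1 => /(_ isT).
- by move=> E; move: (big x); rewrite inE xP E cards1 => /(_ isT).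
- by apply: inj; rewrite inE.
Qed.

Lemma trace_sub G (P : {set T}) x :
  independent G (~: P) -> trace G P x \subset P.
Proof.
move=> iQ; rewrite /trace; case: (boolP (x \in P)) => xP.
  by rewrite sub1set.
apply/subsetP => y; rewrite inE; apply: contraTT => yP.
by apply: iQ; rewrite inE.
Qed.

(** * The graph of odd subsets *)

(** By the count [cT], the injective map [trace G P] reaches every odd subset
    of P; thus G is h^r_e with r = #|P| - 1. *)
Section OddSubsetGraph.
Variables (G : sgraph T) (P : {set T}).
Hypotheses (iP : independent G P) (iQ : independent G (~: P)).
Hypothesis odd_trace : forall x, odd #|trace G P x|.
Hypothesis traceI : injective (trace G P).
Hypotheses (P4 : 3 < #|P|) (cT : #|T| = 2 ^ #|P|.-1).
Local Notation tr := (trace G P).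

Let trP x : tr x \subset P := trace_sub x iQ.

Lemma adjP a x : a \in P -> G a x = (a != x) && (a \in tr x).
Proof.
move=> aP; rewrite /trace; case: (boolP (x \in P)) => xP.
  by rewrite inE (negbTE (iP _ _)) //; case: eqP.
by rewrite inE adj_sym; case: eqVneq => // ax; rewrite -ax aP in xP.
Qed.

Lemma trace_onto (A : {set T}) : A \subset P -> odd #|A| -> exists x, tr x = A.
Proof.
move=> AP Ao.
apply: (inj_onto (D := [set A : {set _} in powerset P | odd #|A| ])) => //.
- by move=> x; rewrite !inE trP odd_trace.
- by rewrite card_odd_subsets ?cT // (leq_trans _ P4).
- by rewrite !inE AP.
Qed.

(** As P has at least four elements, there are z and z' in P other than a and b;
    adding {z, z'} modulo 2 pairs off the odd subsets that contain a and b. *)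
Lemma even_pair a b : a \in P -> b \in P ->
  ~~ odd #|[set x | (a \in tr x) && (b \in tr x)]|.
Proof.
move=> aP bP.
have /card_gt1P[z [z' []]] : 1 < #|P :\: [set a; b]|.
  rewrite -(ltn_add2l #|P :&: [set a; b]|) cardsID.
  apply: leq_ltn_trans P4; rewrite -[3]/(2 + 1) leq_add2r.
  by rewrite (leq_trans (subset_leq_card (subsetIr _ _))) // cards2; case: eqP.
rewrite !inE !negb_or => /andP[/andP[za zb] zP] /andP[/andP[z'a z'b] z'P] zz'.
rewrite -(card_imset _ traceI).
rewrite (@card_flip _ (symdiff^~ [set z; z'])
  (fun A : {set _} => z \in A)) ?odd_double //.
- exact: symdiffK.
- move=> _ /imsetP[x + ->]; rewrite inE => /andP[ax bx].
  have [||y Ey] := @trace_onto (symdiff (tr x) [set z; z']).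
  + by rewrite symdiff_sub // subUset !sub1set zP.
  + by rewrite odd_symdiff cards2 zz' odd_trace.
  rewrite -Ey imset_f // inE Ey !inE ax bx.
  rewrite !(eq_sym a) !(eq_sym b).
  by rewrite (negbTE za) (negbTE zb) (negbTE z'a) (negbTE z'b).
- by move=> A _ /=; rewrite !inE eqxx addbT.
Qed.

(** Only pairs inside P have common neighbours outside P; the common neighbours
    of such a pair are the odd subsets counted in [even_pair]. *)
Lemma lcs_outer s : uniq s -> s =i ~: P -> lcs G s =2 G.
Proof.
move=> us sQ x y; rewrite (lcs_independent_set _ _ iQ us sQ).
case: eqVneq => [->|xy]; rewrite ?addbF //=.
have [/andP[xP yP]|xyP] := boolP ((x \in P) && (y \in P)).
  rewrite (_ : [set v in ~: P | _] = [set v | (x \in tr v) && (y \in tr v)]).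
    by rewrite (negbTE (even_pair xP yP)) addbF.
  apply/setP => v; rewrite !inE /trace; case: ifP => vP;
    rewrite !inE //=.
  by case: (eqVneq x v) => // <-; rewrite eq_sym (negbTE xy).
rewrite (_ : [set v in ~: P | _] = set0) ?cards0 ?addbF //.
apply/setP => v; rewrite !inE; apply/negbTE; apply: contra xyP.
move=> /and3P[vP vx vy]; apply/andP; split.
  by apply: contraLR vx => xP; apply: iQ; rewrite !inE.
by apply: contraLR vy => yP; apply: iQ; rewrite !inE.
Qed.

(** For x and y outside P, every element of the intersection of their traces
    toggles the pair once.  A vertex of P has no neighbour in P, so its
    adjacencies stay, and dot with a singleton is membership. *)
Lemma lcs_inner s : uniq s -> s =i P ->
  forall x y, lcs G s x y = (x != y) && dot (tr x) (tr y).
Proof.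
move=> us sP x y; rewrite (lcs_independent_set _ _ iP us sP).
case: eqVneq => [->|xy]; rewrite ?addbF ?adj_irr //=.
have [xP|xP] := boolP (x \in P).
  rewrite adjP // xy /= {2}/trace xP dot_set1.
  rewrite (_ : [set v in P | _] = set0) ?cards0 ?addbF //.
  apply/setP => v; rewrite !inE; apply/negbTE/negP => /and3P[vP vx _].
  by move: (iP vP xP); rewrite vx.
have [yP|yP] := boolP (y \in P).
  rewrite adj_sym adjP // eq_sym xy /= dotC {2}/trace yP dot_set1.
  rewrite (_ : [set v in P | _] = set0) ?cards0 ?addbF //.
  apply/setP => v; rewrite !inE; apply/negbTE/negP => /and3P[vP _ vy].
  by move: (iP vP yP); rewrite vy.
rewrite (negbTE (iQ _ _)) ?inE //=; congr odd; apply: eq_card => v.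
rewrite !inE; have [vP|vP] := boolP (v \in P).
  have out z : z \notin P -> v != z by apply: contraNneq => <-.
  by rewrite !adjP // !out.
by apply/esym/negbTE; apply: contra vP => /andP[/(subsetP (trP x))].
Qed.

Section Star.
Variable H : sgraph T.
Hypothesis HE : forall x y, H x y = (x != y) && dot (tr x) (tr y).

(** On traces, the isomorphism is F : A |-> A + <A, u>(u + v), with u and v
    standing for their traces.  The vector t = u + v is isotropic, and it is
    orthogonal to u, which makes F an involution.  In <F A, F B> it contributes
    exactly the two correction terms of [elc_gram], as the products
    <A, u><B, u> appear twice. *)
Lemma star_elc_preserved : elc_preserved H.
Proof.
move=> u v uv; have duv : dot (tr u) (tr v).
  by move: uv; rewrite HE => /andP[].
have dxx x : dot (tr x) (tr x) by rewrite /dot setIid odd_trace.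
pose b x y := dot (tr x) (tr y).
pose t := symdiff (tr u) (tr v).
pose F A := if dot A (tr u) then symdiff A t else A.
have dtu : dot t (tr u) = false by rewrite dot_symdiffl dxx dotC duv.
have dtv : dot t (tr v) = false by rewrite dot_symdiffl dxx duv.
have dt A : dot A t = dot A (tr u) (+) dot A (tr v) by apply: dot_symdiffr.
have dtt : dot t t = false by rewrite dt dtu dtv.
have FK : involutive F.
  move=> A; rewrite /F; case dA: (dot A (tr u)); last by rewrite dA.
  by rewrite dot_symdiffl dA dtu symdiffK.
have F_dot A B : dot (F A) (F B) =
    dot A B (+) (dot A (tr u) && dot B (tr v))
            (+) (dot A (tr v) && dot B (tr u)).
  rewrite /F; case dA: (dot A (tr u)); case dB: (dot B (tr u)) => /=;
    rewrite ?(dot_symdiffl A t) ?(dot_symdiffr B t) ?(dotC t B) ?dt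
      ?dA ?dB ?dtt ?dtu ?dtv;
    by case: (dot A B); case: (dot A (tr v)); case: (dot B (tr v)).
have ontoF x : exists y, tr y == F (tr x).
  have [||y Ey] := @trace_onto (F (tr x)); last by exists y; apply/eqP.
    by rewrite /F; case: ifP => // _; rewrite !symdiff_sub.
  (* The size of F A is odd because dot (F A) (F A) = dot A A. *)
  rewrite -[F _]setIid -/(dot _ _) F_dot dxx.
  by case: (dot _ _); case: (dot _ _).
pose f x := xchoose (ontoF x).
have trf x : tr (f x) = F (tr x) by apply/eqP/(xchooseP (ontoF x)).
have fK : involutive f by move=> x; apply: traceI; rewrite !trf FK.
exists f; first by exists f.
have bC : symmetric b by move=> x y; apply: dotC.
move=> x y; rewrite (elc_gram bC dxx HE uv) HE.
by rewrite (inj_eq (can_inj fK)) !trf F_dot.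
Qed.

Lemma star_not_bipartite : 4 < #|P| -> ~ bipartite H.
Proof.
rewrite cardE; case E: (enum P) => [|a1 [|a2 [|a3 [|a4 [|a5 l]]]]] // _.
have := enum_uniq (mem P); rewrite E /= !inE !negb_or -!andbA.
case/and5P=> a12 a13 a14 a15.
case/and5P=> _ a23 a24 a25 /and5P[_ a34 a35 _ /and3P[a45 _ _]].
have inP a : a \in [:: a1; a2; a3; a4; a5] -> a \in P.
  move=> a_in; rewrite -mem_enum E.
  by rewrite (mem_cat a [:: a1; a2; a3; a4; a5] l) a_in.
have triple b c : b \in P -> c \in P -> a1 != b -> a1 != c -> b != c ->
    exists x, tr x = [set a1; b; c].
  move=> bP cP ab ac bc; apply: trace_onto.
    by rewrite !subUset !sub1set bP cP inP // inE eqxx.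
  rewrite setUC cardsU1 cards2 !inE negb_or ab.
  by rewrite eq_sym ac eq_sym bc.
have [||||| x Ex] := triple a2 a3 => //; try by rewrite inP // !inE eqxx ?orbT.
have [||||| y Ey] := triple a4 a5 => //; try by rewrite inP // !inE eqxx ?orbT.
have tr1 : tr a1 = [set a1] by rewrite /trace inP // inE eqxx.
have neq (A B : {set T}) c : c \in A -> c \notin B -> A != B.
  by move=> cA; apply: contraNneq => <-.
apply: (@triangle_not_bipartite H a1 x y); rewrite HE -(inj_eq traceI).
- rewrite tr1 dot_set1 Ex !inE eqxx andbT eq_sym.
  by rewrite (neq _ _ a2) // !inE ?eqxx ?orbT // eq_sym.
- rewrite Ex Ey; apply/andP; split.
    by rewrite (neq _ _ a2) // !inE ?eqxx ?orbT // !negb_or eq_sym a12 a24.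
  rewrite /dot (_ : _ :&: _ = [set a1]) ?cards1 //; apply/setP => z.
  rewrite !inE; case: (eqVneq z a1) => //= _; apply/negbTE/negP.
  case/andP => /orP[]/eqP -> /orP[]; apply/negP; rewrite //.
- rewrite tr1 dot_set1 Ey !inE eqxx andbT eq_sym.
  by rewrite (neq _ _ a4) // !inE ?eqxx ?orbT // eq_sym.
Qed.

End Star.
End OddSubsetGraph.
End LocalComplementation.

(** * The graphs h^r and h^r_e *)

Lemma hr_nbr (r : nat) (V : finType) (h : sgraph V) (U W : {set V}) :
    is_hr r h U W ->
  [/\ W = ~: U, {in W, forall w, 1 < #|nbr h w|}
    & {in W &, injective (nbr h)}].
Proof.
case=> _ [UW dUW _ iW] _ _ [Wi [WE _ _ degW nbrI]].
have WU : W = ~: U.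
  apply/setP => x; rewrite inE; have /setP/(_ x) := UW; rewrite !inE.
  by case: (boolP (x \in U)) => //= xU _; rewrite (disjointFr dUW).
split=> //.
  move=> w; rewrite {1}WE.
  rewrite (big_morph (fun B : {set _} => w \in B) (in_setU w) (in_set0 w)).
  rewrite big_has => /hasP[i]; rewrite mem_index_iota ltnS.
  move=> /[dup] /andP[i2 _] ir wi.
  rewrite (leq_trans i2) // -(degW i ir w wi).
  exact/subset_leq_card/subsetIl.
move=> a b aW bW E; apply/eqP; apply: contraT => ab.
by move: (nbrI _ _ aW bW ab); rewrite E eqxx.
Qed.

(** All nonempty subsets of U are traces.  Those that contain u are paired off
    by adding another element z of U modulo 2, so their number is even; one of
    them is {u} itself, and the others are the neighbours of u. *)
Lemma hr_odd_degree (r : nat) (V : finType) (h : sgraph V) (U W : {set V}) u :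
  1 < r -> is_hr r h U W -> u \in U -> odd #|nbr h u|.
Proof.
move=> r2 hr uU; have [WU deg nbrI] := hr_nbr hr.
case: hr => cV [_ _ iU iW] cU _ _; subst W.
have traceI := trace_inj deg nbrI.
have onto (A : {set V}) : A \subset U -> A != set0 -> exists x, trace h U x = A.
  move=> AU A0; apply: (inj_onto (D := powerset U :\ set0)) => //.
  - move=> x; rewrite !inE trace_sub // andbT /trace.
    case: ifP => xU; first by rewrite -card_gt0 cards1.
    by rewrite -card_gt0 ltnW // deg // inE xU.
  - rewrite cV -cU -card_powerset (cardsD1 set0 (powerset U)).
    by rewrite inE sub0set addKn.
  - by rewrite !inE A0.
have [z zU zu] : exists2 z, z \in U & z != u.
  have: 0 < #|U :\ u| by move: r2; rewrite -cU (cardsD1 u U) uU.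
  by case/card_gt0P => z; rewrite !inE => /andP[]; exists z.
have: ~~ odd #|[set x | u \in trace h U x]|.
  rewrite -(card_imset _ traceI).
  rewrite (@card_flip _ (symdiff^~ [set z])
    (fun A : {set _} => z \in A)) ?odd_double //.
  - exact: symdiffK.
  - move=> _ /imsetP[x + ->]; rewrite inE => ux.
    have us : u \in symdiff (trace h U x) [set z].
      by rewrite !inE ux eq_sym (negbTE zu).
    have [||y Ey] := onto (symdiff (trace h U x) [set z]).
    + by rewrite symdiff_sub ?trace_sub ?sub1set.
    + by apply/set0Pn; exists u.
    by rewrite -Ey imset_f // inE Ey.
  - by move=> A _ /=; rewrite !inE eqxx addbT.
rewrite (cardsD1 u) inE {1}/trace uU set11 /= negbK.
rewrite (_ : [set x | _] :\ u = nbr h u) //; apply/setP => x; rewrite !inE.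
rewrite /trace; case: (boolP (x \in U)) => xU.
  by rewrite inE (negbTE (iU _ _ uU xU)) eq_sym andNb.
rewrite inE adj_sym; case: eqVneq => // xu.
by rewrite xu uU in xU.
Qed.

Lemma card_nbr_even_ext (V : finType) (h : sgraph V) v :
  #|nbr (even_ext h) (Some v)| = ~~ odd #|nbr h v| + #|nbr h v|.
Proof.
rewrite (cardsD1 None) inE /=; congr (_ + _).
rewrite -(card_imset _ Some_inj); apply: eq_card => x.
rewrite !inE; case: x => [x|] /=.
  by rewrite (mem_imset _ _ Some_inj) inE.
by apply/esym/negbTE/negP => /imsetP[].
Qed.

Theorem theorem10 (r : nat) (r_ge3 : 3 <= r) (V : finType) (h : sgraph V)
    (U W : {set V}) (h_hr : is_hr r h U W) :
  (forall s : seq (option V), uniq s -> s =i [set Some w | w in W] ->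
     lcs (even_ext h) s =2 even_ext h) /\
  (exists h_star : sgraph (option V),
     [/\ forall s : seq (option V), uniq s ->
           s =i None |: [set Some u | u in U] ->
           lcs (even_ext h) s =2 h_star,
         elc_preserved h_star
       & 4 <= r -> ~ bipartite h_star]).
Proof.
have [WU deg nbrI] := hr_nbr h_hr.
have odd_deg u := hr_odd_degree (u := u) (ltnW r_ge3) h_hr.
case: h_hr => cV [_ _ iU iW] cU _ _; subst W.
set P := None |: [set Some u | u in U].
have inP x : (Some x \in P) = (x \in U).
  by rewrite !inE (mem_imset _ _ Some_inj).
have NP : None \in P by rewrite !inE.
have QE : [set Some w | w in ~: U] = ~: P.
  apply/setP => -[x|]; rewrite inE ?inP ?NP.
    by rewrite (mem_imset _ _ Some_inj) inE.
  by apply/negbTE/negP => /imsetP[].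
have cP : #|P| = r.+1.
  rewrite cardsU1 card_imset ?cU; last exact: Some_inj.
  by case: imsetP => // -[].
have iP : independent (even_ext h) P.
  move=> [x|] [y|] //; rewrite ?inP.
  - exact: iU.
  - by move=> xU _ /=; rewrite negbK odd_deg.
  - by move=> _ yU /=; rewrite negbK odd_deg.
have iQ : independent (even_ext h) (~: P).
  move=> [x|] [y|]; rewrite !in_setC ?NP // !inP => xU yU.
  by apply: iW; rewrite inE.
have odd_tr x : odd #|trace (even_ext h) P x|.
  rewrite /trace; case: ifP => xP; first by rewrite cards1.
  case: x xP => [x|]; last by rewrite NP.
  by move=> _; rewrite card_nbr_even_ext oddD; case: (odd #|_|).
have traceI : injective (trace (even_ext h) P).
  apply: trace_inj.
    move=> [x|]; rewrite in_setC ?NP // inP => xU.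
    by rewrite card_nbr_even_ext ltn_addl // deg // inE.
  move=> [x|] [y|]; rewrite !in_setC ?NP // !inP => xU yU /setP E.
  congr Some; apply: nbrI; rewrite ?inE //; apply/setP => z.
  by have := E (Some z); rewrite !inE.
have P4 : 3 < #|P| by rewrite cP.
have cT : #|{: option V}| = 2 ^ #|P|.-1.
  by rewrite card_option cV cP subn1 prednK // expn_gt0.
split; first by move=> s us; rewrite QE => sQ; apply: lcs_outer sQ.
have us := enum_uniq (mem P).
have sP : enum P =i P by move=> x; rewrite mem_enum.
have starE := lcs_inner iP iQ us sP.
exists (lcs (even_ext h) (enum P)); split.
- by move=> s us' sP' x y; rewrite starE (lcs_inner iP iQ us' sP').
- exact: star_elc_preserved iQ odd_tr traceI P4 cT _ starE.
- move=> r4; apply: (star_not_bipartite iQ odd_tr traceI P4 cT starE).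
  by rewrite cP.
Qed.
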